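(* Let $S\subset\mathbb{R}^d$ be nonempty and closed and let $\epsilon\geq0$. Suppose that $x^1,\dots,x^n\in\mathbb{R}^{d_0}$, that $F^\nu\subset F^0$ ($\nu\in\mathbb{N}$) and $F\subset F^0\subset\mathrm{usc\text{-}fcns}(S)$ are closed (all of $F^\nu,F,F^0$), that $\psi(x^j,\cdot):F^0\to(-\infty,\infty]$ is continuous for all $j=1,\dots,n$, and that $\pi,\pi^\nu:F^0\to\mathbb{R}$ satisfy $\pi^\nu(g^\nu)\to\pi(g)$ whenever $g^\nu\in F^0\to g$. Moreover, let $\{\epsilon^\nu\geq0,\nu\in\mathbb{N}\}\to\epsilon^\infty$, $\operatorname{Lim}F^\nu=F$, and let $\{f^\nu,\nu\in\mathbb{N}\}$ be generated by the Estimation Algorithm, i.e., for every $\nu\in\mathbb{N}$, $$f^\nu\in\epsilon^\nu\text{-}\operatorname{argmin}_{f\in F^\nu}\ \frac1n\sum_{j=1}^n\psi(x^j,f)+\pi^\nu(f).$$ (i) If $\epsilon^\infty\leq\epsilon$, then $$\epsilon\text{-}\operatorname{argmin}_{f\in F}\ \frac1n\sum_{j=1}^n\psi(x^j,f)+\pi(f)\qquad( * )$$ contains every cluster point of $\{f^\nu,\nu\in\mathbb{N}\}$. (ii) If $\epsilon^\infty<\epsilon$, $F^\nu\subset F$ for all $\nu$, $F^0$ is bounded, and there exists $g\in F$ such that $\psi(x^j,g)<\infty$ for all $j$, then the set $( * )$ contains $f^{\bar\nu}$ for some finite $\bar\nu$.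
   Context: Notation: $\overline{\mathbb{R}}=[-\infty,\infty]$. $\mathrm{usc\text{-}fcns}(S)$ is the set of upper semicontinuous (usc) functions $f:S\to\overline{\mathbb{R}}$ with $f\not\equiv-\infty$. The hypograph is $\operatorname{hypo} f=\{(x,\alpha)\in S\times\mathbb{R}\mid f(x)\geq\alpha\}$. Fix any norm on $\mathbb{R}^d\times\mathbb{R}$ and a point $z^{\rm ctr}\in S\times\mathbb{R}$. The Attouch-Wets (aw) distance is $\mathbf{d}(f,g)=\int_0^\infty \mathbf{d}_\rho(f,g)e^{-\rho}d\rho$, where $\mathbf{d}_\rho(f,g)=\max\{|\operatorname{dist}(z,\operatorname{hypo} f)-\operatorname{dist}(z,\operatorname{hypo} g)| : \|z-z^{\rm ctr}\|\leq\rho\}$ and $\operatorname{dist}$ is the point-to-set distance. All topological notions on $\mathrm{usc\text{-}fcns}(S)$ (convergence, closed, bounded, continuous, cluster point) are with respect to $\mathbf{d}$. Convergence $\mathbf{d}(f^n,f)\to0$ is equivalent to hypo-convergence: $\limsup f^n(x^n)\leq f(x)$ for all $x^n\in S\to x$, and for every $x\in S$ there is $x^n\in S\to x$ with $\liminf f^n(x^n)\geq f(x)$. For $\epsilon\geq0$, $\epsilon\text{-}\operatorname{argmin}_{f\in G}\phi(f)=\{f\in G\mid\phi(f)\leq\inf_{g\in G}\phi(g)+\epsilon\}$. Set limits in $(\mathrm{usc\text{-}fcns}(S),\mathbf{d})$: $\operatorname{OutLim}A^\nu$ is the collection of points to which a subsequence of some sequence $\{a^\nu\in A^\nu\}$ converges;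 $\operatorname{InnLim}A^\nu$ is the collection of points to which some sequence $\{a^\nu\in A^\nu\}$ converges; $\operatorname{Lim}A^\nu=A$ means that both equal $A$. The sample size $n$ is fixed; $\nu$ indexes iterations. *)

(* Defs.v *)
From HB Require Import structures.
From mathcomp Require Import all_boot all_order all_algebra.
From mathcomp Require Import all_classical all_reals all_analysis.
From mathcomp Require Import measurable_realfun.

Set Implicit Arguments.
Unset Strict Implicit.
Unset Printing Implicit Defensive.

Import Order.TTheory GRing.Theory Num.Theory.
Import numFieldNormedType.Exports.

Local Open Scope classical_set_scope.
Local Open Scope ring_scope.

Record norm_on (R : realType) (V : lmodType R) := NormOn {
  norm_val :> V -> R ;
  norm_triangle : forall x y, norm_val (x + y) <= norm_val x + norm_val y ;
  norm_scale : forall (a : R) x, norm_val (a *: x) = `|a| * norm_val x ;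
  norm_definite : forall x, norm_val x = 0 -> x = 0 }.

Definition dist_to (R : realType) (V : lmodType R) (N : norm_on V)
    (z : V) (A : set V) : R :=
  inf [set N (z - a) | a in A].

(* The library only has [lower_semicontinuous]; this is its mirror image. *)
Definition upper_semicontinuous (X : topologicalType) (R : numFieldType)
    (f : X -> \bar R) :=
  forall x a, (f x < a%:E)%E ->
    exists2 V, nbhs x V & forall y, V y -> (f y < a%:E)%E.

(* [S] is coerced to the type of its elements, with the subset topology. *)
Record usc_fcns (R : realType) (d : nat) (S : set 'rV[R]_d) := UscFcns {
  usc_val :> S -> \bar R ;
  usc_valP : upper_semicontinuous usc_val ;
  usc_val_neqNy : usc_val <> cst -oo%E }.

Definition hypo (R : realType) (d : nat) (S : set 'rV[R]_d) (f : usc_fcns S) :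
    set ('rV[R]_d * R^o) :=
  [set xa | exists2 x : S, set_val x = xa.1 & (xa.2%:E <= f x)%E].

Section aw_distance.
Context (R : realType) (d : nat) (S : set 'rV[R]_d).
Context (N : norm_on ('rV[R]_d * R^o)%type) (zctr : 'rV[R]_d * R^o).
Implicit Types f g : usc_fcns S.

Definition aw_dist_at (rho : R) f g : R :=
  sup [set `|dist_to N z (hypo f) - dist_to N z (hypo g)|
      | z in [set z | N (z - zctr) <= rho]].

Definition aw_dist f g : \bar R :=
  (\int[lebesgue_measure]_(rho in `[0%R, +oo[)
    (aw_dist_at rho f g * expR (- rho))%:E)%E.

End aw_distance.

(* Endowed below with the pseudometric structure of [aw_dist]. *)
Definition aw_space (R : realType) (d : nat) (S : set 'rV[R]_d)
    (N : norm_on ('rV[R]_d * R^o)%type) (zctr : 'rV[R]_d * R^o) : Type :=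
  usc_fcns S.

Section aw_pseudometric.
Context (R : realType) (d : nat) (S : set 'rV[R]_d).
Context (N : norm_on ('rV[R]_d * R^o)%type) (zctr : 'rV[R]_d * R^o).
Implicit Types f g h : usc_fcns S.
Local Notation dst := (dist_to N).
Local Notation dat := (aw_dist_at N zctr).
Local Notation daw := (aw_dist N zctr).

Lemma norm_on0 (V : lmodType R) (M : norm_on V) : M 0 = 0.
Proof. by rewrite -(scale0r 0) norm_scale normr0 mul0r. Qed.

Lemma norm_onN (V : lmodType R) (M : norm_on V) x : M (- x) = M x.
Proof. by rewrite -scaleN1r norm_scale normrN normr1 mul1r. Qed.

Lemma norm_on_ge0 (V : lmodType R) (M : norm_on V) x : 0 <= M x.
Proof.
have := norm_triangle M x (- x).
by rewrite subrr norm_on0 norm_onN -mulr2n pmulrn_lge0.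
Qed.

Lemma hypo_nonempty f : hypo f !=set0.
Proof.
have [x fx] : exists x, f x <> -oo%E.
  apply: contrapT => h; apply: (@usc_val_neqNy _ _ _ f); apply/funext => x /=.
  by apply: contrapT => fx; apply: h; exists x.
case E : (f x) fx => [r| |] // _.
  by exists (set_val x, r); exists x => //=; rewrite E.
by exists (set_val x, 0); exists x => //=; rewrite E leey.
Qed.

Lemma dist_to_ge0 z (A : set ('rV[R]_d * R^o)) : 0 <= dst z A.
Proof.
have [->|A0] := eqVneq A set0; first by rewrite /dist_to image_set0 inf0.
apply: lb_le_inf; last by move=> _ [a _ <-]; exact: norm_on_ge0.
by case/set0P: A0 => a Aa; exists (N (z - a)); exists a.
Qed.

Lemma dist_to_le z (A : set ('rV[R]_d * R^o)) a : A a -> dst z A <= N (z - a).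
Proof.
move=> Aa; apply: ge_inf; last by exists a.
by exists 0 => _ [b _ <-]; exact: norm_on_ge0.
Qed.

Definition aw_gaps rho f g : set R :=
  [set `|dst z (hypo f) - dst z (hypo g)| | z in [set z | N (z - zctr) <= rho]].

Lemma aw_gaps_ub rho f g : has_ubound (aw_gaps rho f g).
Proof.
have [a fa] := hypo_nonempty f; have [b gb] := hypo_nonempty g.
exists ((rho + N (zctr - a)) + (rho + N (zctr - b))) => _ [z /= zr <-].
have bnd h c : hypo h c -> dst z (hypo h) <= rho + N (zctr - c).
  move=> hc; apply: le_trans (dist_to_le z hc) _.
  rewrite -(subrKA zctr); apply: le_trans (norm_triangle _ _ _) _.
  by rewrite lerD2r.
apply: le_trans (ler_normB _ _) _.
by rewrite !ger0_norm ?dist_to_ge0 // lerD // bnd.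
Qed.

Lemma aw_gaps_n0 rho f g : 0 <= rho -> aw_gaps rho f g !=set0.
Proof.
move=> r0; exists `|dst zctr (hypo f) - dst zctr (hypo g)|.
by exists zctr => //=; rewrite subrr norm_on0.
Qed.

Lemma aw_gaps_lt0 rho f g : rho < 0 -> aw_gaps rho f g = set0.
Proof.
move=> r0; rewrite -subset0 => _ [z /= zr _].
by have := le_lt_trans zr r0; rewrite ltNge norm_on_ge0.
Qed.

Lemma aw_dist_at_ge0 rho f g : 0 <= dat rho f g.
Proof.
have [r0|r0] := leP 0 rho; last by rewrite /aw_dist_at [X in sup X]aw_gaps_lt0 ?sup0.
have [x Hx] := aw_gaps_n0 f g r0.
apply: le_trans (_ : x <= _); first by case: Hx => z _ <-.
exact: (ub_le_sup (aw_gaps_ub rho f g)).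
Qed.

Lemma aw_dist_at_nd f g : nondecreasing_fun (fun rho => dat rho f g).
Proof.
move=> r s rs; have [r0|r0] := leP 0 r; last first.
  by rewrite /aw_dist_at [X in sup X <= _]aw_gaps_lt0 ?sup0 // aw_dist_at_ge0.
apply: ge_sup; first exact: aw_gaps_n0.
move=> x [z /= zr <-]; apply: (ub_le_sup (aw_gaps_ub s f g)).
by exists z => //=; exact: le_trans rs.
Qed.

Lemma aw_dist_atxx rho f : dat rho f f = 0.
Proof.
apply/eqP; rewrite eq_le aw_dist_at_ge0 andbT.
have [r0|r0] := leP 0 rho; last by rewrite /aw_dist_at [X in sup X <= _]aw_gaps_lt0 ?sup0.
apply: ge_sup; first exact: aw_gaps_n0.
by move=> _ [z _ <-]; rewrite subrr normr0.
Qed.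

Lemma aw_dist_at_sym rho f g : dat rho f g = dat rho g f.
Proof.
rewrite /aw_dist_at; congr sup.
by apply/seteqP; split=> _ [z zr <-]; exists z => //; exact: distrC.
Qed.

Lemma aw_dist_at_triangle rho f g h : dat rho f h <= dat rho f g + dat rho g h.
Proof.
have [r0|r0] := leP 0 rho; last first.
  by rewrite {1}/aw_dist_at [X in sup X <= _]aw_gaps_lt0 ?sup0 // addr_ge0 // aw_dist_at_ge0.
apply: ge_sup; first exact: aw_gaps_n0.
move=> _ [z zr <-]; apply: le_trans (ler_distD (dst z (hypo g)) _ _) _.
by apply: lerD; apply: (ub_le_sup (aw_gaps_ub rho _ _)); exists z.
Qed.

Lemma aw_integrand_ge0 f g rho : (0 <= (dat rho f g * expR (- rho))%:E)%E.
Proof. by rewrite lee_fin mulr_ge0 ?aw_dist_at_ge0 ?expR_ge0. Qed.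

Lemma measurable_aw_integrand (D : set R) f g : measurable D ->
  measurable_fun D (EFin \o (fun rho : R => dat rho f g * expR (- rho))).
Proof.
move=> mD; apply/measurable_EFinP; apply: measurable_funM.
  exact: (nondecreasing_measurable mD (@aw_dist_at_nd f g)).
apply: measurableT_comp; first exact: measurable_expR.
exact: measurable_funN.
Qed.

Lemma aw_distxx f : daw f f = 0%E.
Proof.
rewrite /aw_dist; apply: integral0_eq => rho _.
by rewrite aw_dist_atxx mul0r.
Qed.

Lemma aw_dist_sym f g : daw f g = daw g f.
Proof. by apply: eq_integral => rho _; rewrite aw_dist_at_sym. Qed.

Lemma aw_dist_triangle f g h : (daw f h <= daw f g + daw g h)%E.
Proof.
rewrite /aw_dist -ge0_integralD //; last 4 first.
- by move=> *; exact: aw_integrand_ge0.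
- exact: measurable_aw_integrand.
- by move=> *; exact: aw_integrand_ge0.
- exact: measurable_aw_integrand.
apply: ge0_le_integral => //.
- by move=> *; exact: aw_integrand_ge0.
- exact: measurable_aw_integrand.
- by apply: emeasurable_funD; exact: measurable_aw_integrand.
- move=> rho _; rewrite -EFinD lee_fin -mulrDl ler_wpM2r ?expR_ge0 //.
  exact: aw_dist_at_triangle.
Qed.

Definition aw_ball (f : aw_space S N zctr) (e : R) : set (aw_space S N zctr) :=
  [set g | (daw f g < e%:E)%E].

Lemma aw_ball_center f (e : R) : 0 < e -> aw_ball f e f.
Proof. by move=> e0; rewrite /aw_ball/= aw_distxx lte_fin. Qed.

Lemma aw_ball_sym f g (e : R) : aw_ball f e g -> aw_ball g e f.
Proof. by rewrite /aw_ball/= aw_dist_sym. Qed.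

Lemma aw_ball_triangle f g h e1 e2 :
  aw_ball f e1 g -> aw_ball g e2 h -> aw_ball f (e1 + e2) h.
Proof.
rewrite /aw_ball/= => fg gh; apply: le_lt_trans (aw_dist_triangle f g h) _.
by rewrite EFinD lteD.
Qed.

HB.instance Definition _ := gen_eqMixin (aw_space S N zctr).
HB.instance Definition _ := gen_choiceMixin (aw_space S N zctr).
HB.instance Definition _ := hasNbhs.Build (aw_space S N zctr)
  (nbhs_ (entourage_ aw_ball)).
HB.instance Definition _ := @Nbhs_isPseudoMetric.Build R (aw_space S N zctr)
  (entourage_ aw_ball) erefl aw_ball aw_ball_center aw_ball_sym
  aw_ball_triangle erefl.

Definition aw_bounded (A : set (aw_space S N zctr)) :=
  exists M : R, forall f g, A f -> A g -> (daw f g <= M%:E)%E.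

End aw_pseudometric.

Definition eps_argmin (R : realType) (T : Type) (eps : R) (G : set T)
    (phi : T -> \bar R) : set T :=
  [set f | G f /\ (phi f <= ereal_inf [set phi g | g in G] + eps%:E)%E].

Definition OutLim (T : topologicalType) (A : nat -> set T) : set T :=
  [set a | exists2 u : nat -> T, (forall nu, A nu (u nu)) &
     exists2 s : nat -> nat, increasing_seq s & (u \o s) @ \oo --> a].

Definition InnLim (T : topologicalType) (A : nat -> set T) : set T :=
  [set a | exists2 u : nat -> T, (forall nu, A nu (u nu)) & u @ \oo --> a].

Definition set_Lim (T : topologicalType) (A : nat -> set T) (B : set T) :=
  OutLim A = B /\ InnLim A = B.

Definition sample_objective (R : realType) (d0 n : nat) (T : Type)
    (psi : 'rV[R]_d0 -> T -> \bar R) (x : 'I_n -> 'rV[R]_d0) (pi : T -> R)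
    (f : T) : \bar R :=
  ((n%:R^-1)%:E * \sum_(j < n) psi (x j) f + (pi f)%:E)%E.

(* Main.v *)
Require Import Defs.
From HB Require Import structures.
From mathcomp Require Import all_boot all_order all_algebra.
From mathcomp Require Import all_classical all_reals all_analysis.
From mathcomp Require Import measurable_realfun ring lra.
Import Order.TTheory GRing.Theory Num.Theory.
Import numFieldNormedType.Exports.
Local Open Scope classical_set_scope.
Local Open Scope ring_scope.

(* A cluster point f of the iterates is the limit of f_ along some filter G
   finer than the cofinite one, and along G both sides of
   phi^nu(f_nu) <= phi^nu(g_nu) + eps_nu converge, where g_nu in F_nu tends to
   an arbitrary g in F; this gives (i) with eps_oo in place of eps.  For (ii),
   G is taken to be an ultrafilter, and a limit f exists because bounded sets of
   usc functions are relatively compact: the distance functions to the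
   hypographs are 1-Lipschitz, hence converge pointwise along G, and the zero
   set of the limit is the hypograph of f.  Then phi(f_nu) -> phi(f) <=
   inf phi + eps_oo < inf phi + eps along G. *)

(** * Subsequences, filters and cluster points *)

Lemma frequently_subseq (P : nat -> nat -> Prop) :
  (forall k m, exists2 i, (m < i)%N & P k i) ->
  exists2 s : nat -> nat, increasing_seq s & forall k, P k (s k).
Proof.
move=> H.
have /choice[c cP] : forall km : nat * nat, exists i, (km.2 < i)%N /\ P km.1 i.
  by case=> k m; have [i] := H k m; exists i.
pose s := fix s k := c (k, if k is k'.+1 then s k' else 0%N).
exists s; last by case=> [|k]; [exact: (cP (0, 0)%N).2|exact: (cP (k.+1, s k)).2].
by apply/increasing_seqP => k; exact: (cP (k.+1, s k)).1.
Qed.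

Lemma increasing_seq_leq (s : nat -> nat) k : increasing_seq s -> (k <= s k)%N.
Proof.
move=> /increasing_seqP sS; elim: k => // k; move/leq_ltn_trans; apply.
exact: sS.
Qed.

(** Every set of [G] is infinite, as [G] is proper and contains the cofinite sets; so each ball
    around [a] is visited at arbitrarily late indices. This turns filter limits into the
    subsequences that [OutLim] asks for. *)
Lemma cvg_subseq_of_filter {R : realType} (T : pseudoMetricType R)
    (G : set_system nat) (u : nat -> T) (a : T) : ProperFilter G ->
  \oo `<=` G -> u @ G --> a ->
  exists2 s : nat -> nat, increasing_seq s & (u \o s) @ \oo --> a.
Proof.
move=> PG ooG ua.
have [|s si sP] := @frequently_subseq (fun k i => ball a k.+1%:R^-1 (u i)).
  move=> k m.
  have H1 : G [set i | ball a k.+1%:R^-1 (u i)].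
    by apply: ua; apply: nbhsx_ballx; rewrite invr_gt0.
  have H2 : G [set i | (m < i)%N] by apply: ooG; exists m.+1.
  by have [i [? ?]] := filter_ex (filterI H1 H2); exists i.
exists s => //; apply/cvg_ballP => e e0.
near=> k; apply: le_ball (sP k); apply: ltW.
near: k; exact: near_infty_natSinv_lt (PosNum e0).
Unshelve. all: by end_near. Qed.

(** Take for [G] the filter generated by the tails and the preimages of neighbourhoods of [a];
    clustering says exactly that these always meet. *)
Lemma cluster_filter {T : topologicalType} (u : nat -> T) (a : T) :
  cluster (u @ \oo) a ->
  exists G : set_system nat, [/\ ProperFilter G, \oo `<=` G & u @ G --> a].
Proof.
move=> cl.
pose G := [set A | exists B : set nat * set T,
  [/\ \oo B.1, nbhs a B.2 & B.1 `&` u @^-1` B.2 `<=` A]].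
exists G; split.
- split.
    move=> [B [B1 B2 Bs]].
    have uB1 : (u @ \oo) (u @` B.1) by apply: filterS B1 => i B1i; exists i.
    by have [_ [[i B1i <-] B2i]] := cl _ _ uB1 B2; exact: (Bs i).
  split.
  + by exists (setT, setT); split=> //; exact: filterT.
  + move=> A B [A' [A1 A2 As]] [B' [B1 B2 Bs]].
    exists (A'.1 `&` B'.1, A'.2 `&` B'.2); split; [exact: filterI..|].
    by move=> i [[? ?] [? ?]]; split; [apply: As|apply: Bs].
  + move=> A B AB [A' [A1 A2 As]]; exists A'; split => //.
    exact: subset_trans AB.
- by move=> A A0; exists (A, setT); split => [//| |i []//]; exact: filterT.
- by move=> A aA; exists (setT, A); split => [|//|i []//]; exact: filterT.
Qed.

(** Limits above [-oo] keep the sum of limits away from [+oo - oo], where addition is not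
    continuous. *)
Lemma cvge_sum_gtNy {R : realType} (I J : Type) (G : set_system I) (r : seq J)
    (f : J -> I -> \bar R) (l : J -> \bar R) : Filter G ->
  (forall j, -oo < l j)%E -> (forall j, f j @ G --> l j) ->
  (\sum_(j <- r) f j i)%E @[i --> G] --> (\sum_(j <- r) l j)%E.
Proof.
move=> FG lNy fl; elim: r => [|j r IH].
  by rewrite big_nil; under eq_fun do rewrite big_nil; exact: cvg_cst.
rewrite big_cons; under eq_fun do rewrite big_cons.
apply: cvgeD => //; have := @adde_def_sum R J j r xpredT l; apply => k _.
by apply: ltninfty_adde_def; rewrite inE.
Qed.

Lemma within_filter_cvg {T : topologicalType} {I : Type} (G : set_system I)
    (D : set T) (u : I -> T) (a : T) : Filter G ->
  (forall i, D (u i)) -> u @ G --> a -> u @ G --> within D (nbhs a).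
Proof.
move=> FG Du ua A wA; have : G (u @^-1` [set h | D h -> A h]) by exact: ua.
by apply: (@filterS _ G) => i /= /(_ (Du i)).
Qed.

(** * Continuous convergence of the penalties *)

Section continuous_convergence.
Context {R : realType} {T : pseudoMetricType R} (D : set T).
Variables (p_ : nat -> T -> R) (p : T -> R).
Hypothesis p_cvg : forall (g_ : nat -> T) (g : T),
  (forall nu, D (g_ nu)) -> D g -> g_ @ \oo --> g ->
  p_ nu (g_ nu) @[nu --> \oo] --> p g.

(* A bad sequence in [D] along a subsequence of indices extends, by the
   constant [a], to a full sequence contradicting [p_cvg]. *)
Lemma continuous_convergence_prod a : D a ->
  p_ x.1 x.2 @[x --> filter_prod \oo (within D (nbhs a))] --> p a.
Proof.
move=> Da; apply/cvgrPdist_lt => e e0; apply: contrapT => nH.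
have [|s si sP] := @frequently_subseq
    (fun k i => exists h, [/\ D h, ball a k.+1%:R^-1 h & e <= `|p a - p_ i h|]).
  move=> k m; apply: contrapT => H; apply: nH.
  exists ([set i | (m < i)%N], D `&` ball a k.+1%:R^-1) => /=.
    split; first by exists m.+1.
    have : nbhs a (ball a k.+1%:R^-1) by apply: nbhsx_ballx; rewrite invr_gt0.
    by apply: filterS => h.
  case=> i h /= [mi [Dh ah]]; rewrite ltNge; apply/negP => eh; apply: H.
  by exists i => //; exists h.
have [h hP] := choice sP.
pose g i := if pselect (exists k, s k = i) is left ki
  then h (projT1 (cid ki)) else a.
have gs k : g (s k) = h k.
  rewrite /g; case: pselect => [ki|[]]; last by exists k.
  by case: (cid ki) => l /= /(increasing_seq_injective si) ->.
have Dg i : D (g i).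
  rewrite /g; case: pselect => // ki; by have [] := hP (projT1 (cid ki)).
have ga : g @ \oo --> a.
  apply/cvg_ballP => r r0.
  have [K _ KP] := near_infty_natSinv_lt (PosNum r0).
  exists (s K) => // i /= sKi; rewrite /g.
  case: pselect => [ki|_]; last exact: ballxx.
  case: (cid ki) => k /= ski; have [_ + _] := hP k; apply: le_ball.
  by apply/ltW/KP => /=; rewrite -(si K k) ski.
have /cvgrPdist_lt/(_ e e0)[K _ KP] := p_cvg _ _ Dg Da ga.
have [_ _] := hP K; have := KP (s K) (increasing_seq_leq _ K si).
by rewrite /= gs => /lt_le_trans h1 /h1; rewrite ltxx.
Qed.

(** The limit [p] inherits continuity on [D]: in the joint estimate, freeze [h] and let [nu] grow
    along the constant sequence [h]; the strict bound becomes a weak one. *)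
Lemma continuous_convergence_within a : D a ->
  p h @[h --> within D (nbhs a)] --> p a.
Proof.
move=> Da; apply/cvgrPdist_le => e e0.
have /cvgrPdist_lt/(_ e e0)[[A B] /= [A0 B0] AB] := continuous_convergence_prod _ Da.
apply: (@filterS _ (nbhs a)) B0 => h Bh Dh.
have hc : p_ nu h @[nu --> \oo] --> p h by apply: p_cvg => //; exact: cvg_cst.
have hl : `|p a - p_ nu h| @[nu --> \oo] --> `|p a - p h|.
  by apply: cvg_norm; apply: cvgB => //; exact: cvg_cst.
apply: (cvgr_to_le hl); apply: filterS A0 => i Ai.
by apply/ltW/(AB (i, h)); split => //; exact: Bh.
Qed.

End continuous_convergence.

(** * Convergence and finiteness of the sample objective *)

(** The penalty [q] may vary with the index, so the lemma serves both the approximating objectives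
    and the fixed limit objective. *)
Lemma sample_objective_cvg {R : realType} (d0 n : nat) (T : topologicalType)
    (psi : 'rV[R]_d0 -> T -> \bar R) (x : 'I_n -> 'rV[R]_d0) (D : set T)
    (I : Type) (G : set_system I) (u : I -> T) (q : I -> T -> R) (p : T -> R)
    (a : T) : Filter G ->
  (forall j f, D f -> (-oo < psi (x j) f)%E) ->
  (forall j, {within D, continuous (psi (x j))}) ->
  (forall i, D (u i)) -> D a -> u @ G --> a ->
  q i (u i) @[i --> G] --> p a ->
  sample_objective psi x (q i) (u i) @[i --> G] --> sample_objective psi x p a.
Proof.
move=> FG psiNy psic Du Da ua qa; apply: cvgeD.
- exact: fin_num_adde_defl.
- apply: cvgeZl => //; apply: cvge_sum_gtNy => j; first exact: psiNy.
  have /subspace_continuousP/(_ a Da) h := psic j.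
  exact: cvg_comp (within_filter_cvg G D u a FG Du ua) h.
- by apply: cvg_EFin => //; exact: nearW.
Qed.

Lemma sample_objective_gtNy {R : realType} (d0 n : nat) (T : Type)
    (psi : 'rV[R]_d0 -> T -> \bar R) (x : 'I_n -> 'rV[R]_d0) (p : T -> R) f :
  (forall j, -oo < psi (x j) f)%E -> (-oo < sample_objective psi x p f)%E.
Proof.
move=> psiNy; rewrite ltNye adde_eq_ninfty negb_or andbT.
have sNy : (\sum_(j < n) psi (x j) f != -oo)%E.
  by rewrite esum_eqNy; apply/existsPn => j; rewrite /= -ltNye.
case: (\sum_(j < n) _)%E sNy => [r _| _|] //.
(* Only the sum [+oo] is left; a zero factor, the inverse of [n = 0], makes the product 0, and a
   positive one keeps it at [+oo]. *)
have : 0 <= n%:R^-1 :> R by rewrite invr_ge0.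
by rewrite le0r => /predU1P[->|n0]; rewrite ?mul0e // gt0_muley.
Qed.

Lemma sample_objective_lty {R : realType} (d0 n : nat) (T : Type)
    (psi : 'rV[R]_d0 -> T -> \bar R) (x : 'I_n -> 'rV[R]_d0) (p : T -> R) f :
  (forall j, -oo < psi (x j) f)%E -> (forall j, psi (x j) f < +oo)%E ->
  (sample_objective psi x p f < +oo)%E.
Proof.
move=> psiNy psiy; rewrite lte_add_pinfty ?ltry //.
have : (\sum_(j < n) psi (x j) f)%E \is a fin_num.
  by apply/sum_fin_numP => j _ _; rewrite fin_numElt psiNy psiy.
by move=> /EFin_fin_numP[r ->]; rewrite ltry.
Qed.

(** * Compactness and equivalence of norms *)

(** An ultrafilter converges to each of its cluster points: otherwise [G] would contain the
    complement of the preimage of some neighbourhood. *)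
Lemma compact_ultra_cvg (I : Type) (T : topologicalType) (G : set_system I)
    (K : set T) (u : I -> T) : UltraFilter G -> compact K ->
  (forall i, K (u i)) -> exists2 a, K a & u @ G --> a.
Proof.
move=> GU cK Ku; have PG : ProperFilter G by exact: ultra_proper.
have [a [Ka cla]] := cK (u @ G) _ (@filterE _ G _ _ Ku).
exists a => // A aA; have [//|GnA] := in_ultra_setVsetC (u @^-1` A) GU.
by have [y []] := cla (~` A) A GnA aA.
Qed.

Section norm_on_product.
Context {R : realType} {d : nat} (N : norm_on ('rV[R]_d * R^o)%type).
Implicit Types z w : 'rV[R]_d * R^o.

Lemma norm_on_sum (V : lmodType R) (M : norm_on V) (I : Type) (r : seq I)
    (F : I -> V) : M (\sum_(i <- r) F i) <= \sum_(i <- r) M (F i).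
Proof.
elim: r => [|i r IH]; first by rewrite !big_nil norm_on0.
by rewrite !big_cons (le_trans (norm_triangle M _ _)) // lerD2l.
Qed.

Lemma norm_on_distC (V : lmodType R) (M : norm_on V) (x y : V) :
  M (x - y) = M (y - x).
Proof. by rewrite -norm_onN opprB. Qed.

Lemma norm_coord_le (v : 'rV[R]_d) i : `|v 0 i| <= `|v|.
Proof.
rewrite [leRHS]/Num.norm /= mx_normrE.
exact: (le_bigmax _ (fun ij : 'I_1 * 'I_d => `|v ij.1 ij.2|) (0, i)).
Qed.

Lemma norm_on_le : exists2 C : R, 0 < C & forall z, N z <= C * `|z|.
Proof.
pose C := \sum_(i < d) N (delta_mx 0 i, 0) + N (0, 1).
have C0 : 0 <= C.
  rewrite addr_ge0 ?norm_on_ge0 // sumr_ge0 // => i _; exact: norm_on_ge0.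
(* [C] bounds [N] by expansion along the standard basis; adding 1 makes the constant positive at
   once. *)
exists (C + 1) => [|[v a]]; first by rewrite ltr_wpDl.
have va : (v, a) = \sum_(i < d) v 0 i *: (delta_mx 0 i, 0) + a *: (0, 1)
    :> 'rV[R]_d * R^o.
  have -> : \sum_(i < d) v 0 i *: (delta_mx 0 i, 0) = (v, 0) :> 'rV[R]_d * R^o.
    rewrite [in RHS](row_sum_delta v).
    elim: (index_enum _) => [|i r IH]; first by rewrite !big_nil.
    rewrite !big_cons IH; congr (_, _).
    by rewrite /= scaler0 addr0.
  congr (_, _) => /=; first by rewrite scaler0 addr0.
  by rewrite add0r /GRing.scale /= mulr1.
apply: (@le_trans _ _ (C * `|(v, a)|)); last by rewrite ler_wpM2r // lerDl.
rewrite [X in N X]va mulrDl.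
apply: le_trans (norm_triangle N _ _) _; rewrite lerD //.
  apply: le_trans (norm_on_sum _ _ _ _ _) _; rewrite mulr_suml ler_sum // => i _.
  rewrite norm_scale mulrC ler_wpM2l ?norm_on_ge0 //.
  by rewrite [leRHS]/Num.norm /= le_max norm_coord_le.
rewrite norm_scale mulrC ler_wpM2l ?norm_on_ge0 //.
by rewrite [leRHS]/Num.norm /= le_max lexx orbT.
Qed.
Lemma norm_on_dist z w : `|N z - N w| <= N (z - w).
Proof.
have tri x y : N x - N y <= N (x - y).
  by rewrite lerBlDr; have := norm_triangle N (x - y) y; rewrite subrK.
by rewrite ler_norml tri andbT lerNl opprB norm_on_distC tri.
Qed.

Lemma compact_prod_ball (r : R) : compact [set z : 'rV[R]_d * R^o | `|z| <= r].
Proof.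
have -> : [set z : 'rV[R]_d * R^o | `|z| <= r] =
    [set v | `|v| <= r] `*` [set a : R^o | `|a| <= r].
  by apply/seteqP; split=> -[v a];
    rewrite /= [in X in X -> _]/Num.norm /= ge_max => /andP.
apply: compact_setX.
  apply: bounded_closed_compact; last first.
    exact: (preimage_closed (fun v _ => @norm_continuous _ _ v) (@closed_le _ r)).
  exists r; split; first exact: num_real.
  by move=> M rM v /= /le_trans; apply; exact: ltW.
have -> : [set a : R^o | `|a| <= r] = `[- r, r]%classic.
  by apply/seteqP; split=> a /=; rewrite in_itv /= ler_norml.
exact: segment_compact.
Qed.

(** [N] is continuous and attains a positive minimum on the compact unit sphere; [c] is the inverse
    of that minimum. *)
Lemma norm_on_ge : exists2 c : R, 0 < c & forall z, `|z| <= c * N z.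
Proof.
have [C C0 NC] := norm_on_le.
pose K : set ('rV[R]_d * R^o) := [set z | `|z| = 1].
have K0 : K !=set0.
  exists (0, 1); rewrite /K /= [LHS]/Num.norm /=.
  by rewrite /ProdNormedZmodule.norm /= normr0 normr1 max_r.
have cK : compact K.
  apply: (subclosed_compact _ (compact_prod_ball 1)); last by move=> z /= ->.
  exact: (preimage_closed (fun z _ => @norm_continuous _ _ z) (@closed_eq _ 1)).
have cN : continuous N.
  move=> z; apply/cvgrPdist_lt => e e0.
  have : nbhs z (ball z (e / C)) by apply: nbhsx_ballx; rewrite divr_gt0.
  apply: filterS => w; rewrite -ball_normE /= ltr_pdivlMr // mulrC => zw.
  exact: le_lt_trans (norm_on_dist _ _) (le_lt_trans (NC _) zw).
have [z /set_mem zK Nz] := compact_EVT_min K0 cK (continuous_subspaceT cN).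
have Nz0 : 0 < N z.
  rewrite lt_def norm_on_ge0 andbT; apply/eqP => /norm_definite z0.
  by move: zK; rewrite /K /= z0 normr0 => /eqP; rewrite eq_sym oner_eq0.
exists (N z)^-1 => [|w]; first by rewrite invr_gt0.
have [->|w0] := eqVneq w 0; first by rewrite normr0 norm_on0 mulr0.
have nw0 : 0 < `|w| by rewrite normr_gt0.
have : N z <= N (`|w|^-1 *: w).
  apply: Nz; rewrite inE /K /= normrZ normrV ?unitfE ?gt_eqF // normr_id.
  by rewrite mulVf // gt_eqF.
rewrite norm_scale ger0_norm ?invr_ge0 // mulrC ler_pdivlMr //.
by rewrite mulrC -ler_pdivlMr // mulrC.
Qed.

(** By equivalence of norms the points stay in a compact ball. Topological convergence serves the
    coordinates, convergence in [N] the distance estimates. *)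
Lemma norm_on_bounded_ultra (I : Type) (G : set_system I) c r
    (z_ : I -> 'rV[R]_d * R^o) : UltraFilter G ->
  (forall i, N (z_ i - c) <= r) ->
  exists2 z : 'rV[R]_d * R^o, z_ @ G --> z & N (z_ i - z) @[i --> G] --> 0.
Proof.
move=> GU zr; have PG : ProperFilter G by exact: ultra_proper.
have [C C0 NC] := norm_on_le; have [k k0 Nk] := norm_on_ge.
have [|z _ zz] := compact_ultra_cvg _ _ G _ z_ GU (compact_prod_ball (k * r + `|c|)).
  move=> i /=; rewrite -[z_ i](subrK c).
  apply: le_trans (ler_normD _ _) _; rewrite lerD2r.
  by apply: le_trans (Nk _) _; rewrite ler_pM2l.
exists z => //; apply/cvgrPdist_lt => e e0.
have /cvgrPdist_lt/(_ (e / C)) : z_ @ G --> z by [].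
rewrite divr_gt0 // => /(_ isT); apply: filterS => i.
rewrite ltr_pdivlMr // mulrC sub0r normrN ger0_norm ?norm_on_ge0 // norm_on_distC.
exact: le_lt_trans.
Qed.

Lemma dist_to_lip (A : set ('rV[R]_d * R^o)) z w : A !=set0 ->
  `|dist_to N z A - dist_to N w A| <= N (z - w).
Proof.
move=> [a0 Aa0].
have lip x y : dist_to N x A - dist_to N y A <= N (x - y).
  rewrite lerBlDr -lerBlDl; apply: lb_le_inf; first by exists (N (y - a0)), a0.
  move=> _ [a Aa <-]; rewrite lerBlDl; apply: le_trans (dist_to_le N x Aa) _.
  by rewrite -(subrKA y); exact: norm_triangle.
by rewrite ler_norml lip andbT lerNl opprB norm_on_distC lip.
Qed.

Lemma dist_to_adherent (A : set ('rV[R]_d * R^o)) z e : A !=set0 -> 0 < e ->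
  exists2 a, A a & N (z - a) < dist_to N z A + e.
Proof.
move=> [a0 Aa0] e0.
have [|_ [a Aa <-] aP] := @inf_adherent _ [set N (z - a) | a in A] e e0.
  split; first by exists (N (z - a0)), a0.
  by exists 0 => _ [a _ <-]; exact: norm_on_ge0.
by exists a.
Qed.

End norm_on_product.

(** * Two-sided bounds for the Attouch-Wets distance *)

Section aw_distance_bounds.
Context {R : realType} {d : nat} {S : set 'rV[R]_d}.
Context (N : norm_on ('rV[R]_d * R^o)%type) (zctr : 'rV[R]_d * R^o).
Implicit Types f g : usc_fcns S.
Local Notation dst := (dist_to N).
Local Notation dat := (aw_dist_at N zctr).
Local Notation daw := (aw_dist N zctr).

Lemma aw_dist_at_gap rho f g z : N (z - zctr) <= rho ->
  `|dst z (hypo f) - dst z (hypo g)| <= dat rho f g.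
Proof. by move=> zr; apply: (ub_le_sup (aw_gaps_ub N zctr rho f g)); exists z. Qed.

(* Moving [z] to the ball of radius [r] along the ray from [zctr] costs
   [rho - r] in each of the two 1-Lipschitz distances. *)
Lemma aw_dist_at_growth r rho f g : 0 <= r -> r <= rho ->
  dat rho f g <= dat r f g + 2 * (rho - r).
Proof.
move=> r0 rrho; apply: ge_sup; first by apply: aw_gaps_n0; exact: le_trans rrho.
move=> _ [z /= zrho <-].
have [w wr zw] : exists2 w, N (w - zctr) <= r & N (z - w) <= rho - r.
  have [zr|rz] := leP (N (z - zctr)) r.
    by exists z => //; rewrite subrr norm_on0 subr_ge0.
  have Nz0 : 0 < N (z - zctr) by exact: le_lt_trans rz.
  pose t := r / N (z - zctr).
  have t1 : t <= 1 by rewrite ler_pdivrMr // mul1r ltW.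
  exists (zctr + t *: (z - zctr)).
    rewrite addrC addKr norm_scale ger0_norm ?divr_ge0 ?(ltW Nz0) //.
    by rewrite divfK // gt_eqF.
  rewrite opprD addrA -{1}[z - zctr]scale1r -scalerBl norm_scale.
  rewrite ger0_norm ?subr_ge0 // mulrBl mul1r divfK ?gt_eqF //.
  by rewrite lerB.
have := aw_dist_at_gap r f g w wr.
have := dist_to_lip N _ z w (hypo_nonempty f).
have := dist_to_lip N _ z w (hypo_nonempty g).
move: (dst z _) (dst w _) (dst z _) (dst w _) => a b a' b'.
rewrite !ler_norml => /andP[? ?] /andP[? ?] /andP[? ?]; apply/andP; split; lra.
Qed.

(** Split [expR (- rho)] into two equal factors: one absorbs the linear growth [2 * (rho - r)]
    through [1 + t <= expR t], the other stays integrable. For [rho < r] monotonicity in the radius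
    suffices. *)
Lemma aw_dist_at_expR r rho f g : 0 <= r -> 0 <= rho ->
  dat rho f g * expR (- rho) <=
  (dat r f g + 4 * expR (- (r / 2))) * expR (- (rho / 2)).
Proof.
move=> r0 rho0.
have -> : expR (- rho) = expR (- (rho / 2)) * expR (- (rho / 2)).
  by rewrite -expRD -opprD -splitr.
rewrite mulrA ler_wpM2r ?expR_ge0 //.
have datr : 0 <= dat r f g by exact: aw_dist_at_ge0.
have e1 : expR (- (rho / 2)) <= 1 by rewrite expR_le1 oppr_le0 divr_ge0.
have [rrho|rhor] := leP r rho.
  have -> : expR (- (r / 2)) = expR ((rho - r) / 2) * expR (- (rho / 2)).
    by rewrite -expRD; congr expR; field.
  have := expR_ge1Dx ((rho - r) / 2).
  have := aw_dist_at_growth r rho f g r0 rrho.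
  have : 0 <= expR (- (rho / 2)) by exact: expR_ge0.
  move: (expR _) (expR _) e1 (dat _ _ _) (dat _ _ _) datr => e E ? a b ? ? ? ?.
  nra.
apply: (@le_trans _ _ (dat r f g)); last by rewrite lerDl mulr_ge0 ?expR_ge0.
apply: le_trans (ler_piMr _ e1) _; first exact: aw_dist_at_ge0.
exact/aw_dist_at_nd/ltW.
Qed.

(** Smallness at one large radius forces smallness of the integral. The factor 2 arises because
    [expR (- (rho / 2))] is twice the exponential density of rate 1/2. *)
Lemma aw_dist_le r f g : 0 <= r ->
  (daw f g <= (2 * (dat r f g + 4 * expR (- (r / 2))))%:E)%E.
Proof.
move=> r0; set c := dat r f g + _.
have c0 : 0 <= c by rewrite addr_ge0 ?aw_dist_at_ge0 ?mulr_ge0 ?expR_ge0.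
have half0 : 0 < 2^-1 :> R by rewrite invr_gt0.
have mpdf (D : set R) : measurable D ->
    measurable_fun D (EFin \o (fun x : R => 2 * c * exponential_pdf 2^-1 x)).
  move=> mD; apply/measurable_EFinP; apply: measurable_funM => //.
  by apply: (measurable_funS measurableT) => //; exact: measurable_exponential_pdf.
have pdf0 x : (0 <= (2 * c * exponential_pdf 2^-1 x)%:E)%E.
  by rewrite lee_fin !mulr_ge0 // exponential_pdf_ge0 // ltW.
apply: (@le_trans _ _ (\int[lebesgue_measure]_(rho in `[0%R, +oo[)
    ((2 * c) * exponential_pdf 2^-1 rho)%:E)%E).
  apply: ge0_le_integral => //.
  - by move=> *; exact: aw_integrand_ge0.
  - exact: measurable_aw_integrand.
  - exact: mpdf.
  - move=> rho /=; rewrite in_itv /= andbT => rho0.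
    rewrite lee_fin exponential_pdfE //.
    rewrite (_ : _ * _ * _ = c * expR (- (rho / 2))); first exact: aw_dist_at_expR.
    by rewrite mulNr [2^-1 * rho]mulrC; field.
apply: (@le_trans _ _ (\int[lebesgue_measure]_rho
    (2 * c * exponential_pdf 2^-1 rho)%:E)%E).
  by apply: ge0_subset_integral => //; exact: mpdf.
under eq_integral do rewrite EFinM.
rewrite ge0_integralZl //; last 3 first.
- by apply/measurable_EFinP; exact: measurable_exponential_pdf.
- by move=> x _; rewrite lee_fin exponential_pdf_ge0 // ltW.
- by rewrite lee_fin mulr_ge0.
by rewrite integral_exponential_pdf // mule1.
Qed.

(** On [[0, 1]] both factors of the integrand are bounded below, by their values at radius 0 and
    radius 1 respectively. *)
Lemma aw_dist_ge f g : ((dat 0 f g * expR (- 1))%:E <= daw f g)%E.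
Proof.
apply: (@le_trans _ _ (\int[lebesgue_measure]_(rho in `[0%R, 1%R])
    (dat rho f g * expR (- rho))%:E)%E).
  have -> : (dat 0 f g * expR (- 1))%:E =
      (\int[@lebesgue_measure R]_(rho in `[0%R, 1%R]) (dat 0 f g * expR (- 1))%:E)%E.
    by rewrite integral_cst //= lebesgue_measure_itv /= lte01 oppr0 adde0 mule1.
  apply: ge0_le_integral => //.
  - by move=> *; rewrite lee_fin mulr_ge0 ?aw_dist_at_ge0 ?expR_ge0.
  - exact: measurable_aw_integrand.
  - move=> rho /=; rewrite in_itv /= => /andP[rho0 rho1].
    rewrite lee_fin ler_pM ?aw_dist_at_ge0 ?expR_ge0 ?aw_dist_at_nd //.
    by rewrite ler_expR lerN2.
apply: ge0_subset_integral => //.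
- exact: measurable_aw_integrand.
- by move=> *; exact: aw_integrand_ge0.
- by move=> x /=; rewrite !in_itv /= => /andP[->].
Qed.

End aw_distance_bounds.

(** * Zero sets of Lipschitz functions as hypographs *)

Section zero_set_hypograph.
Context {R : realType} {d : nat} {S : set 'rV[R]_d}.
Context (N : norm_on ('rV[R]_d * R^o)%type) (D : 'rV[R]_d * R^o -> R).
Hypothesis D_ge0 : forall z, 0 <= D z.
Hypothesis D_lip : forall z w, `|D z - D w| <= N (z - w).
Hypothesis D_down : forall v (a b : R), b <= a -> D (v, b) <= D (v, a).
Hypothesis D_S : forall z, D z = 0 -> S z.1.

(** Upper envelope of the zero set; the supremum over an empty fibre is [-oo]. *)
Let sup_zero (x : S) : \bar R :=
  ereal_sup [set a%:E | a in [set a : R | D (set_val x, a) = 0]].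

Let sup_zero_ge (x : S) a : D (set_val x, a) = 0 -> (a%:E <= sup_zero x)%E.
Proof. by move=> Da; apply: ereal_sup_ubound; exists a. Qed.

Let sup_zero_le (x : S) b : 0 < D (set_val x, b) -> (sup_zero x <= b%:E)%E.
Proof.
move=> Db; apply: ge_ereal_sup => _ [c /= Dc <-]; rewrite lee_fin leNgt.
apply/negP => /ltW /(D_down (set_val x)); rewrite Dc leNgt Db //.
Qed.

(** Positivity survives a small downward move by the Lipschitz bound. This yields strict
    inequalities for the supremum, hence that finite suprema are attained. *)
Let D_gt0_below v (a : R) : 0 < D (v, a) -> exists2 b, b < a & 0 < D (v, b).
Proof.
(* [M] exceeds [N (0, 1)], so a descent by [D (v, a) / M] lowers [D] by less than [D (v, a)]. *)
move=> Da; pose M : R := N (0, 1) + 1.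
have M0 : 0 < M by rewrite ltr_wpDl ?norm_on_ge0.
exists (a - D (v, a) / M); first by rewrite ltrBlDr ltrDl divr_gt0.
have := D_lip (v, a) (v, a - D (v, a) / M).
have -> : (v, a) - (v, a - D (v, a) / M) =
    (D (v, a) / M) *: (0, 1) :> 'rV[R]_d * R^o.
  congr (_, _) => /=; first by rewrite subrr scaler0.
  by rewrite opprB addrC subrK /GRing.scale /= mulr1.
have q0 : 0 <= D (v, a) / M by rewrite divr_ge0 ?(ltW M0).
rewrite norm_scale (ger0_norm q0) ler_norml => /andP[_].
rewrite lerBlDl => h; rewrite -(ltrD2r (D (v, a) / M * N (0, 1))) add0r.
apply: lt_le_trans h; rewrite mulrAC ltr_pdivrMr // ltr_pM2l //.
by rewrite ltrDl.
Qed.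

Let sup_zero_lt (x : S) (a : R) : 0 < D (set_val x, a) -> (sup_zero x < a%:E)%E.
Proof.
by move=> /D_gt0_below[b ba /sup_zero_le /le_lt_trans]; apply; rewrite lte_fin.
Qed.

Lemma zero_set_hypo : [set z | D z = 0] !=set0 ->
  exists f : usc_fcns S, hypo f = [set z | D z = 0].
Proof.
move=> [z0 Dz0].
have [C C0 NC] := norm_on_le N.
have usc : upper_semicontinuous sup_zero.
  move=> x a fxa.
  have : 0 < D (set_val x, a).
    rewrite lt_neqAle D_ge0 andbT eq_sym; apply/eqP => /sup_zero_ge.
    by rewrite leNgt fxa.
  move=> /D_gt0_below[b ba Db].
  (* Within this radius the Lipschitz bound keeps [D] positive at height [b], so the envelope stays
     at most [b < a]. *)
  exists (set_val @^-1` ball (set_val x) (D (set_val x, b) / C)).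
    apply: (@initial_continuous S _ set_val x).
    by apply: nbhsx_ballx; rewrite divr_gt0.
  move=> y /=; rewrite -ball_normE /= ltr_pdivlMr // mulrC => xy.
  apply: (@le_lt_trans _ _ b%:E); last by rewrite lte_fin.
  apply: sup_zero_le; rewrite ltNge; apply/negP => Dy.
  have := le_trans (D_lip (set_val x, b) (set_val y, b)) (NC _).
  have -> : `|(set_val x, b) - (set_val y, b)| = `|set_val x - set_val y| :> R.
    by rewrite [LHS]/Num.norm /= /ProdNormedZmodule.norm /= subrr normr0 max_l.
  have -> : D (set_val y, b) = 0 by apply/le_anti; rewrite Dy D_ge0.
  by rewrite subr0 ger0_norm // leNgt xy.
have nNy : sup_zero <> cst -oo%E.
  have Sz0 := D_S z0 Dz0.
  move=> /(congr1 (fun f => f (SigSub (mem_set Sz0)))) /= h.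
  have := sup_zero_ge (SigSub (mem_set Sz0)) z0.2.
  by rewrite h -surjective_pairing => /(_ Dz0).
exists (UscFcns usc nNy); apply/seteqP; split=> [[v a] [x /= xv fa]|[v a] Dz].
  apply: contrapT => /eqP Da; move: fa; rewrite leNgt sup_zero_lt //.
  by rewrite xv lt_neqAle eq_sym Da D_ge0.
exists (SigSub (mem_set (D_S (v, a) Dz))) => //=.
exact: sup_zero_ge.
Qed.

End zero_set_hypograph.

(** Shift an almost nearest point down by [a - b]: it stays in the hypograph, and its offset from
    the base point is unchanged. *)
Lemma dist_to_hypo_down {R : realType} {d : nat} {S : set 'rV[R]_d}
    (N : norm_on ('rV[R]_d * R^o)%type) (f : usc_fcns S) v (a b : R) : b <= a ->
  dist_to N (v, b) (hypo f) <= dist_to N (v, a) (hypo f).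
Proof.
move=> ba; apply/ler_addgt0Pr => e e0.
have [[w c] [x /= xw fx] wc] := dist_to_adherent N _ (v, a) e (hypo_nonempty f) e0.
apply: le_trans (ltW wc).
have h : hypo f (w, c - (a - b)).
  exists x => //=; apply: le_trans fx.
  by rewrite lee_fin gerBl subr_ge0.
apply: le_trans (dist_to_le N _ h) _.
suff -> : (v, b) - (w, c - (a - b)) = (v, a) - (w, c) :> 'rV[R]_d * R^o by [].
by congr (_, _) => /=; ring.
Qed.

(** * Ultralimits of hypographs *)

Section ultralimit.
Context {R : realType} {d : nat} {S : set 'rV[R]_d}.
Context (N : norm_on ('rV[R]_d * R^o)%type) (zctr : 'rV[R]_d * R^o).
Context (G : set_system nat).
Hypothesis S_closed : closed S.
Hypothesis GU : UltraFilter G.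
Hypothesis ooG : \oo `<=` G.
Variables (u : nat -> usc_fcns S) (B : R).
Local Notation dst := (dist_to N).
Hypothesis uB : forall i, dst zctr (hypo (u i)) <= B.

Let PG : ProperFilter G. Proof. exact: ultra_proper. Qed.

Let harmonicG : i.+1%:R^-1 @[i --> G] --> (0 : R).
Proof. exact: cvg_trans (cvg_app _ ooG) cvg_harmonic. Qed.

Let u_le i z : dst z (hypo (u i)) <= B + N (z - zctr).
Proof.
rewrite -lerBlDl; apply: le_trans (dist_to_lip N _ z zctr (hypo_nonempty (u i))).
by apply: le_trans (ler_norm _); rewrite lerB.
Qed.

Let pointwise_cvg :
  exists D : 'rV[R]_d * R^o -> R, forall z, dst z (hypo (u i)) @[i --> G] --> D z.
Proof.
have /choice[D uD] : forall z, exists l : R, dst z (hypo (u i)) @[i --> G] --> l.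
  move=> z; have [|l _ ?] := compact_ultra_cvg _ R G `[0, B + N (z - zctr)]
    (fun i => dst z (hypo (u i))) GU (@segment_compact _ _ _); last by exists l.
  by move=> i /=; rewrite in_itv /= dist_to_ge0 u_le.
by exists D.
Qed.

(** Almost nearest points of the hypographs are bounded, hence converge along [G]. Their limit is a
    zero of [D], and its first component lies in [S] by closedness. *)
Let nearest_point (D : 'rV[R]_d * R^o -> R) :
  (forall z, dst z (hypo (u i)) @[i --> G] --> D z) ->
  forall z, exists a, [/\ D a = 0, S a.1 & N (z - a) <= D z].
Proof.
move=> uD z.
have /choice[a_ aP] i : exists a, hypo (u i) a /\
    N (z - a) < dst z (hypo (u i)) + i.+1%:R^-1.
  have [|a ? ?] := dist_to_adherent N (hypo (u i)) z i.+1%:R^-1 (hypo_nonempty _).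
    by rewrite invr_gt0.
  by exists a.
have [i|a aa Naa] := norm_on_bounded_ultra N _ G z (B + N (z - zctr) + 1) a_ GU.
  rewrite norm_on_distC; apply: le_trans (ltW (aP i).2) _.
  by rewrite lerD ?u_le // invf_le1 // ler1n.
exists a; split.
- have ua : dst a (hypo (u i)) @[i --> G] --> (0 : R).
    apply: (squeeze_cvgr _ (cvg_cst 0) Naa); apply: nearW => i.
    by rewrite dist_to_ge0 norm_on_distC; exact: dist_to_le (aP i).1.
  exact: (cvg_unique _ (uD a) ua).
- have a1 : fst (a_ i) @[i --> G] --> a.1.
    apply: (@cvg_comp _ _ _ a_ fst G (nbhs a) (nbhs a.1) aa).
    exact: cvg_fst.
  apply: (@closed_cvg _ _ G _ (fun i => fst (a_ i)) S S_closed _ a.1 a1).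
  apply: nearW => i.
  by have [[x /= <- _] _] := aP i; exact: set_valP.
- have rhs : dst z (hypo (u i)) + i.+1%:R^-1 + N (a_ i - a) @[i --> G] -->
      D z + 0 + 0.
    by apply: cvgD => //; apply: cvgD.
  rewrite !addr0 in rhs; apply: (cvgr_to_ge rhs); apply: nearW => i.
  rewrite -(subrKA (a_ i)); apply: le_trans (norm_triangle _ _ _) _.
  by rewrite lerD2r ltW // (aP i).2.
Qed.

Lemma dist_to_hypo_ultralimit : exists f : usc_fcns S,
  forall z, dst z (hypo (u i)) @[i --> G] --> dst z (hypo f).
Proof.
have [D uD] := pointwise_cvg.
have D_ge0 z : 0 <= D z.
  by apply: (cvgr_to_ge (uD z)); apply: nearW => i; exact: dist_to_ge0.
have D_lip z w : `|D z - D w| <= N (z - w).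
  have h : `|dst z (hypo (u i)) - dst w (hypo (u i))| @[i --> G] --> `|D z - D w|.
    by apply: cvg_norm; apply: cvgB.
  by apply: (cvgr_to_le h); apply: nearW => i; apply: dist_to_lip (hypo_nonempty _).
have D_down v (a b : R) : b <= a -> D (v, b) <= D (v, a).
  move=> ba; rewrite -subr_ge0.
  apply: (cvgr_to_ge (cvgB (uD (v, a)) (uD (v, b)))); apply: nearW => i.
  by rewrite subr_ge0 dist_to_hypo_down.
(* At a zero of [D] the nearest point has distance 0, so it is the point itself. *)
have D_S z : D z = 0 -> S z.1.
  move=> Dz; have [a [_ Sa]] := nearest_point D uD z.
  rewrite Dz => za; suff -> : z = a by [].
  apply/eqP; rewrite -subr_eq0; apply/eqP/(norm_definite (n := N)).
  by apply/le_anti; rewrite za norm_on_ge0.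
have [|f fD] := zero_set_hypo N D D_ge0 D_lip D_down D_S.
  by have [a [Da _ _]] := nearest_point D uD zctr; exists a.
exists f => z; suff -> : dst z (hypo f) = D z by exact: uD.
(* One inequality comes from a nearest zero of [D], the other from the Lipschitz bound between [z]
   and any zero. *)
apply/le_anti/andP; split.
  have [a [Da _ za]] := nearest_point D uD z.
  by apply: le_trans za; apply: dist_to_le; rewrite fD.
have [a0 fa0] := hypo_nonempty f.
apply: lb_le_inf; first by exists (N (z - a0)), a0.
move=> _ [a + <-]; rewrite fD /= => Da; apply: le_trans (D_lip z a).
by rewrite Da subr0 ler_norm.
Qed.

(** For 1-Lipschitz functions pointwise convergence is uniform on bounded sets: almost maximal gaps
    sit at points [z_ i] converging to some [z], and moving from [z_ i] to [z] costs [N (z_ i - z)]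
    for each distance. *)
Lemma aw_dist_at_ultralimit (f : usc_fcns S) r : 0 <= r ->
  (forall z, dst z (hypo (u i)) @[i --> G] --> dst z (hypo f)) ->
  aw_dist_at N zctr r f (u i) @[i --> G] --> 0.
Proof.
move=> r0 uf.
have /choice[z_ zP] i : exists z, N (z - zctr) <= r /\
    aw_dist_at N zctr r f (u i) - i.+1%:R^-1 <=
    `|dst z (hypo f) - dst z (hypo (u i))|.
  have [||_ [z zr <-] zP] := @sup_adherent _ (aw_gaps N zctr r f (u i)) i.+1%:R^-1.
  - by rewrite invr_gt0.
  - by split; [exact: aw_gaps_n0|exact: aw_gaps_ub].
  by exists z; split => //; exact: ltW.
have [z _ zz] := norm_on_bounded_ultra N _ G zctr r z_ GU (fun i => (zP i).1).
pose bnd i :=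
  `|dst z (hypo f) - dst z (hypo (u i))| + N (z_ i - z) *+ 2 + i.+1%:R^-1.
suff bnd0 : bnd @ G --> 0.
  apply: (squeeze_cvgr _ (cvg_cst 0) bnd0).
  apply: nearW => i; rewrite aw_dist_at_ge0 /= -lerBlDr.
  apply: le_trans (zP i).2 _.
  set p := dst z (hypo f) - dst z (hypo (u i)).
  have := ler_norm p; have := ler_norm (- p); rewrite normrN {1 3}/p.
  have := dist_to_lip N _ (z_ i) z (hypo_nonempty f).
  have := dist_to_lip N _ (z_ i) z (hypo_nonempty (u i)).
  rewrite mulr2n !ler_norml => /andP[? ?] /andP[? ?] ? ?.
  by apply/andP; split; lra.
have -> : 0 = `|dst z (hypo f) - dst z (hypo f)| + 0 *+ 2 + 0 :> R.
  by rewrite subrr normr0 mul0rn !addr0.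
apply: cvgD => //; apply: cvgD; last exact: cvgMn.
by apply: cvg_norm; apply: cvgB => //; exact: cvg_cst.
Qed.

End ultralimit.

(** * Relative compactness of bounded sets *)

Lemma aw_relatively_compact {R : realType} (d : nat) (S : set 'rV[R]_d) N zctr
    (M : R) (u : nat -> aw_space S N zctr) (G : set_system nat) :
  closed S -> UltraFilter G -> \oo `<=` G ->
  (forall i j, (aw_dist N zctr (u i) (u j) <= M%:E)%E) ->
  exists f : aw_space S N zctr, u @ G --> f.
Proof.
move=> S_closed GU ooG uM; have PG : ProperFilter G by exact: ultra_proper.
(* The lower bound [aw_dist_ge] controls the gap at [zctr] between [u i] and [u 0] by
   [M / expR (- 1)]. *)
pose B := M / expR (- 1) + dist_to N zctr (hypo (u 0%N)).
have uB i : dist_to N zctr (hypo (u i)) <= B.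
  rewrite -lerBlDr ler_pdivlMr ?expR_gt0 //.
  have := le_trans (aw_dist_ge N zctr (u i) (u 0%N)) (uM _ _); rewrite lee_fin.
  apply: le_trans; rewrite ler_pM2r ?expR_gt0 //.
  apply: le_trans (ler_norm _) _; apply: aw_dist_at_gap.
  by rewrite subrr norm_on0.
have [f uf] := dist_to_hypo_ultralimit N zctr G S_closed GU ooG u B uB.
exists f; apply/cvg_ballP => e e0.
(* In [aw_dist_le] the tail is [8 * expR (- (r / 2))]; taking [r / 2 = 16 / e] and using
   [t < expR t] puts it below [e / 2]. A gap below [e / 4] then supplies the other half. *)
have [r r0 re] : exists2 r : R, 0 <= r & 8 * expR (- (r / 2)) < e / 2.
  exists (2 * (16 / e)); first by rewrite !mulr_ge0 ?invr_ge0 ?(ltW e0).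
  rewrite mulrAC divff ?mul1r //.
  have e16 : 0 < 16 / e by rewrite divr_gt0.
  have : (expR (16 / e))^-1 < (16 / e)^-1.
    rewrite ltf_pV2 ?posrE ?expR_gt0 //.
    by apply: lt_le_trans (expR_ge1Dx _); rewrite ltrDr.
  by rewrite invf_div expRN => ?; lra.
have /cvgrPdist_lt/(_ (e / 4)) := aw_dist_at_ultralimit N zctr G GU ooG u f r r0 uf.
rewrite divr_gt0 // => /(_ isT); apply: filterS => i.
rewrite sub0r normrN ger0_norm ?aw_dist_at_ge0 // => ri.
apply: (le_lt_trans (aw_dist_le N zctr r f (u i) r0)).
rewrite lte_fin; lra.
Qed.

(** * Near-minimizers and their limits *)

(** Comparison with one competitor at a time is the form that passes to limits. *)
Lemma eps_argminP {R : realType} (T : Type) (eps : R) (G : set T)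
    (phi : T -> \bar R) f :
  eps_argmin eps G phi f <->
  G f /\ forall g, G g -> (phi f <= phi g + eps%:E)%E.
Proof.
split=> -[Gf fG]; split => //.
  move=> g Gg; apply: le_trans fG _.
  by rewrite leeD2r // ereal_inf_lbound //; exists g.
rewrite -leeBlDr //; apply: le_ereal_inf_tmp => _ [g Gg <-].
by rewrite leeBlDr // fG.
Qed.

Theorem theorem5p1 (R : realType) (d d0 n : nat) (S : set 'rV[R]_d)
  (N : norm_on ('rV[R]_d * R^o)%type) (zctr : 'rV[R]_d * R^o)
  (eps eps_oo : R) (eps_ : nat -> R)
  (x : 'I_n -> 'rV[R]_d0)
  (F0 F : set (aw_space S N zctr)) (F_ : nat -> set (aw_space S N zctr))
  (psi : 'rV[R]_d0 -> aw_space S N zctr -> \bar R)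
  (pi : aw_space S N zctr -> R) (pi_ : nat -> aw_space S N zctr -> R)
  (f_ : nat -> aw_space S N zctr) :
  S !=set0 -> closed S -> S zctr.1 ->
  0 <= eps -> (0 < n)%N ->
  (forall nu, F_ nu `<=` F0) -> F `<=` F0 ->
  closed F0 -> closed F -> (forall nu, closed (F_ nu)) ->
  (forall j f, F0 f -> (-oo < psi (x j) f)%E) ->
  (forall j, {within F0, continuous (psi (x j))}) ->
  (forall (g_ : nat -> aw_space S N zctr) (g : aw_space S N zctr),
    (forall nu, F0 (g_ nu)) -> F0 g -> g_ @ \oo --> g ->
    pi_ nu (g_ nu) @[nu --> \oo] --> pi g) ->
  (forall nu, 0 <= eps_ nu) -> eps_ @ \oo --> eps_oo ->
  set_Lim F_ F ->
  (forall nu, eps_argmin (eps_ nu) (F_ nu)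
    (sample_objective psi x (pi_ nu)) (f_ nu)) ->
  (eps_oo <= eps ->
    cluster (f_ @ \oo) `<=` eps_argmin eps F (sample_objective psi x pi)) /\
  (eps_oo < eps -> (forall nu, F_ nu `<=` F) -> aw_bounded F0 ->
    (exists2 g, F g & forall j, (psi (x j) g < +oo)%E) ->
    exists nubar, eps_argmin eps F (sample_objective psi x pi) (f_ nubar)).
Proof.
move=> _ Scl _ _ _ F_F0 FF0 _ _ _ psiNy psic picvg _ epscvg [outF innF] fmin.
set phi := sample_objective psi x pi.
have F_f nu : F_ nu (f_ nu) by have [] := fmin nu.
have F0f nu : F0 (f_ nu) by apply: F_F0 (F_f nu).
have limit_argmin (G : set_system nat) f : ProperFilter G -> \oo `<=` G ->
    f_ @ G --> f -> eps_argmin eps_oo F phi f.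
  move=> PG ooG ff.
  have Ff : F f.
    rewrite -outF; have [s si sf] := cvg_subseq_of_filter _ G f_ f PG ooG ff.
    by exists f_ => //; exists s.
  apply/eps_argminP; split => // g Fg.
  have [g_ F_g gg] : InnLim F_ g by rewrite innF.
  have phi_cvg u a : (forall nu, F0 (u nu)) -> F0 a -> u @ G --> a ->
      sample_objective psi x (pi_ nu) (u nu) @[nu --> G] --> phi a.
    move=> F0u F0a ua; apply: (sample_objective_cvg _ _ _ _ _ F0) => //.
    (* Pairing index and point lets [pi_ nu (u nu)] converge along [G], although the hypothesis
       speaks of full sequences. *)
    have h : (nu, u nu) @[nu --> G] --> filter_prod \oo (within F0 (nbhs a)).
      exact: (cvg_pair ooG (within_filter_cvg G F0 u a _ F0u ua)).
    exact: cvg_comp h (continuous_convergence_prod F0 pi_ pi picvg a F0a).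
  have rhs_cvg : (sample_objective psi x (pi_ nu) (g_ nu) + (eps_ nu)%:E)%E
      @[nu --> G] --> (phi g + eps_oo%:E)%E.
    apply: cvgeD; first exact: fin_num_adde_defl.
      apply: phi_cvg; [by move=> nu; exact: F_F0 (F_g nu)|exact: FF0|].
      exact: cvg_trans (cvg_app _ ooG) gg.
    apply: cvg_EFin; first exact: nearW.
    exact: cvg_trans (cvg_app _ ooG) epscvg.
  apply: (lee_cvg_to (phi_cvg f_ f F0f (FF0 _ Ff) ff) rhs_cvg).
  by apply: nearW => nu; have /eps_argminP[_] := fmin nu; exact.
split.
  move=> eps_le f /cluster_filter[G [PG ooG ff]].
  have /eps_argminP[Ff fF] := limit_argmin G f PG ooG ff.
  apply/eps_argminP; split => // g /fF /le_trans; apply.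
  by rewrite leeD2l // lee_fin.
move=> eps_lt F_F [M F0M] [g Fg psig].
have [G [GU ooG]] := @ultraFilterLemma _ \oo _.
have [f ff] := aw_relatively_compact _ _ _ _ M f_ G Scl GU
  ooG (fun i j => F0M _ _ (F0f i) (F0f j)).
have PG : ProperFilter G by exact: ultra_proper.
have /eps_argminP[Ff fF] := limit_argmin G f PG ooG ff.
(* Here the penalty is the fixed [pi], so its continuity on [F0] is what enters. *)
have phi_cvg : phi (f_ nu) @[nu --> G] --> phi f.
  apply: (sample_objective_cvg _ _ _ _ _ F0 _ _ _ (fun=> pi)) => //.
    exact: FF0.
  have h : f_ @ G --> within F0 (nbhs f) by exact: within_filter_cvg.
  apply: cvg_comp h (continuous_convergence_within F0 pi_ pi picvg f _).
  exact: FF0.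
(* Finiteness makes [phi f < phi f + (eps - eps_oo)] strict; the upper bound comes from the
   competitor [g] with finite losses. *)
have phif : phi f \is a fin_num.
  rewrite fin_numElt sample_objective_gtNy /=; last by move=> j; exact/psiNy/FF0.
  apply: le_lt_trans (fF g Fg) _; rewrite lte_add_pinfty ?ltry //.
  by apply: sample_objective_lty => // j; exact/psiNy/FF0.
have : G [set nu | (phi (f_ nu) < phi f + (eps - eps_oo)%:E)%E].
  apply: (phi_cvg [set y | (y < phi f + (eps - eps_oo)%:E)%E]).
  apply: open_nbhs_nbhs; split; first exact: open_ereal_lt_ereal.
  by rewrite /= lteDl // lte_fin subr_gt0.
move=> /filter_ex[nu /= nuP]; exists nu; apply/eps_argminP; split.
  exact: F_F (F_f nu).
move=> h Fh; apply: le_trans (ltW nuP) _.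
rewrite EFinB addeA addeAC leeD2r // leeBlDr //; exact: fF.
Qed.
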